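(* The cluster algebra $\mathbb{C}[\mathbb{G}(3,7)]$ possesses exactly forty-two cluster variables. Twenty-eight of these are the Plücker coordinates $\Delta^{ijk}$ with $\{i,j,k\}\subset[1\dots7]$ an internal $3$-subset, and the remaining fourteen are the quadratic regular functions $X^{[1\dots7]-i}$ and $Y^{[1\dots7]-i}$ for $i\in[1\dots7]$.
   Context: Grassmannian. $X(k,n)\subset\bigwedge^k\mathbb{C}^n$ is the affine cone of decomposable $k$-forms, with Plücker coordinates $\Delta^K$ indexed by $k$-subsets $K\subset\{1,\dots,n\}$. $\mathbb{C}[\mathbb{G}(k,n)]$ denotes the coordinate ring of $X(k,n)$. A $k$-subset is internal if it is not a cyclic interval modulo $n$. The functions $X$ and $Y$. On $\mathbb{G}(3,6)$ put $X^{123456}=\Delta^{134}\Delta^{256}-\Delta^{156}\Delta^{234}$ and $Y^{123456}=\Delta^{145}\Delta^{236}-\Delta^{123}\Delta^{456}$. For $n>6$ and $I\subset[1\dots n]=\{1,\dots,n\}$ with complement of cardinality six, $X^{[1\dots n]-I}$ (resp. $Y^{[1\dots n]-I}$) is the composition of $X^{123456}$ (resp. $Y^{123456}$) with the projection $\mathbb{G}(3,n)\to\mathbb{G}(3,6)$ forgetting the columns indexed by $I$ of the $3\times n$ matrix representing a point; i.e. if $[1\dots n]-I=\{a_1<\dots<a_6\}$ one replaces the index $r$ by $a_r$ in the formulas. Seeds and mutation. A seed in a field $\mathcal{F}$ of rational functions over $\mathbb{C}$ in $M$ variables is a triple $(\mathbf{x},\mathbf{c},\tilde B)$ where $\tilde{\mathbf{x}}=\mathbf{x}\sqcup\mathbf{c}$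 is a transcendence basis of $\mathcal{F}$ ($M$ algebraically independent elements) and $\tilde B=(b_{x,y})$ is an integer matrix with rows indexed by $\tilde{\mathbf x}$ and columns by $\mathbf{x}$ whose square submatrix with rows in $\mathbf{x}$ is skew-symmetrizable. For $z\in\mathbf{x}$, $\mu_z(\mathbf{x},\mathbf{c},\tilde B)=(\mathbf{x}-\{z\}\cup\{z'\},\mathbf{c},\tilde B')$, where $zz'=\prod_{b_{x,z}>0}x^{b_{x,z}}+\prod_{b_{x,z}<0}x^{-b_{x,z}}$ and $b'_{x,y}=-b_{x,y}$ if $x=z$ or $y=z$, $b'_{x,y}=b_{x,y}+\frac{|b_{x,z}|b_{z,y}+b_{x,z}|b_{z,y}|}{2}$ otherwise (index $z$ renamed $z'$). Clusters are the sets $\mathbf{x}$ in seeds obtained from an initial seed by iterated mutation; their elements are the cluster variables. Cluster structure on $\mathbb{C}[\mathbb{G}(k,n)]$ (here $k=3$, $n=7$). $\mathcal{F}$ is the fraction field of $\mathbb{C}[\mathbb{G}(k,n)]$. For $0\le i\le k$, $0\le j\le n-k$ put $p_{ij}=n-k-\lfloor\frac{i+j-2}{2}\rfloor$, $p'_{ij}=n-k+2+\lfloor\frac{i+j-1}{2}\rfloor$ and $I_{ij}=\{p_{ij},\dots,p_{ij}+i-1\}\sqcup\{p'_{ij},\dots,p'_{ij}+k-i-1\}$ (mod $n$; only non-corner pairs $(i,j)$ are used). The initial cluster is $\{\Delta^{I_{ij}}: 1\le i\le k-1,\ 1\le j\le n-k-1\}$; the coefficients $\mathbf{c}$ are the $\Delta^{K}$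 for the $n$ cyclic intervals $K$ of length $k$ (these are the $I_{ij}$ with $i\in\{0,k\}$ or $j\in\{0,n-k\}$). In the column of $\tilde B$ indexed by $I_{ij}$ the entries in rows $I_{i\pm1,j}$ equal $(-1)^{i+j}$, the entries in rows $I_{i,j\pm1}$ equal $-(-1)^{i+j}$, and all other entries are $0$. *)

(* Defs.v *)
From HB Require Import structures.
From mathcomp Require Export all_boot all_order all_algebra.
From mathcomp Require Export generic_quotient ring_quotient fraction.
From mathcomp Require Export complex boolp classical_sets cardinality reals.
From mathcomp Require Export mpoly.

Set Implicit Arguments.
Unset Strict Implicit.
Unset Printing Implicit Defensive.

Import Order.TTheory GRing.Theory Num.Theory.
Local Open Scope ring_scope.

Section Seeds.
Variables (C F : fieldType) (iota : {rmorphism C -> F}).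

Definition algebraically_independent (T : finType) (x : T -> F) : Prop :=
  forall p : {mpoly C[#|T|]}, mmap iota (x \o enum_val) p = 0 -> p = 0.

(* A maximal algebraically independent family; [oapp x y : option T -> F] is
   the family [x] extended by the element [y]. *)
Definition transcendence_basis (T : finType) (x : T -> F) : Prop :=
  algebraically_independent x /\
  forall y : F, ~ algebraically_independent (oapp x y).

Definition skew_symmetrizable (T : Type) (b : T -> T -> int) : Prop :=
  exists d : T -> nat, (forall x, (0 < d x)%N) /\
    forall x y, (d x)%:Z * b x y = - ((d y)%:Z * b y x).

(* The raw data of a seed.  The cluster is indexed by [I], the coefficients by
   [J], and the rows and columns of the matrix by [I + J] and [I] respectively,
   instead of by the elements of F themselves.  For a seed this is only a
   labelling, since an algebraically independent family is injective; mutation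
   at z gives the new variable z' the label of z. *)
Record preseed (I J : Type) := Preseed {
  cluster : I -> F;
  coefs : J -> F;
  exch : I + J -> I -> int }.

Definition ext_cluster I J (S : preseed I J) (r : I + J) : F :=
  match r with inl i => cluster S i | inr j => coefs S j end.

Definition is_seed (I J : finType) (S : preseed I J) : Prop :=
  transcendence_basis (ext_cluster S) /\
  skew_symmetrizable (fun x y : I => exch S (inl x) y).

Definition mutate (I J : finType) (S : preseed I J) (z : I) : preseed I J :=
  let b := exch S in
  {| cluster := fun i =>
       if i == z then
         (\prod_(r | 0 < b r z) ext_cluster S r ^+ `|b r z|%N +
          \prod_(r | b r z < 0) ext_cluster S r ^+ `|b r z|%N) / cluster S z
       else cluster S i;
     coefs := coefs S;
     (* the division by 2 is exact *)
     exch := fun x y =>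
       if (x == inl z) || (y == z) then - b x y
       else b x y +
         ((`|b x z| * b (inl z) y + b x z * `|b (inl z) y|) %/ 2)%Z |}.

(* The seeds obtained from S0, which is itself required to be a seed, by iterated
   mutation; mutation preserves [is_seed]. *)
Inductive mutation_class (I J : finType) (S0 : preseed I J) :
    preseed I J -> Prop :=
| mutation_class_init : is_seed S0 -> mutation_class S0 S0
| mutation_class_step S z :
    mutation_class S0 S -> mutation_class S0 (mutate S z).

Definition cluster_variables (I J : finType) (S0 : preseed I J) : set F :=
  [set f | exists2 S, mutation_class S0 S & exists i, f = cluster S i]%classic.

End Seeds.

Notation ksubset k n := {K : {set 'I_n} | #|K| == k}.

(* [enum_val] lists K in increasing order, so this is its j-th smallest element. *)
Definition ksubset_val k n (K : ksubset k n) (j : 'I_k) : 'I_n :=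
  enum_val (cast_ord (esym (eqP (valP K))) j).

(* The coordinate on the basis vector e_K of the exterior product of the rows
   of A. *)
Definition minor (R : comNzRingType) k n (A : 'M[R]_(k, n)) (K : ksubset k n)
  : R := \det (colsub (ksubset_val K) A).

Section Grassmannian.
Variables (C : numFieldType) (k n : nat).

Local Notation N := #|{: ksubset k n}|.

(* A k-form w is given by its coordinates on the basis (e_K). *)
Definition decomposable (w : {ffun ksubset k n -> C}) : Prop :=
  exists A : 'M[C]_(k, n), w = [ffun K => minor A K].

Definition vanishing : {pred {mpoly C[N]}} :=
  fun f => `[< forall w, decomposable w -> f.@[w \o enum_val] = 0 >].

Lemma vanishingP f :
  reflect (forall A : 'M[C]_(k, n), f.@[fun i => minor A (enum_val i)] = 0)
          (f \in vanishing).
Proof.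
rewrite unfold_in; apply: (iffP (asboolP _)) => [h A | h w [A ->]].
  rewrite -(h [ffun K => minor A K]); last by exists A.
  by apply: meval_eq => i /=; rewrite ffunE.
by rewrite -(h A); apply: meval_eq => i /=; rewrite ffunE.
Qed.

Lemma vanishing_idealr : idealr_closed vanishing.
Proof.
split.
- by apply/vanishingP => A; rewrite meval0.
- by apply/negP => /vanishingP/(_ 0)/eqP; rewrite meval1 oner_eq0.
- move=> a u v /vanishingP hu /vanishingP hv; apply/vanishingP => A.
  by rewrite mevalD mevalM hu hv mulr0 addr0.
Qed.

Lemma poly_eval0 (p : {poly C}) : (forall t, p.[t] = 0) -> p = 0.
Proof.
move=> h; apply: (@roots_geq_poly_eq0 _ _ [seq i%:R | i <- iota 0 (size p)]).
- by apply/allP => x _; apply/rootP/h.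
- by rewrite map_inj_uniq ?iota_uniq //; apply: (mulrIn (oner_neq0 _)).
- by rewrite size_map size_iota.
Qed.

(* The matrices form an affine space: restrict to the line through two of them. *)
Lemma vanishing_prime : prime_idealr_closed vanishing.
Proof.
move=> u v /vanishingP huv; apply/orP; apply: contrapT => /not_orP[uN vN].
have /existsNP[A hA] : ~ forall A : 'M[C]_(k, n),
  u.@[fun i => minor A (enum_val i)] = 0 by move/vanishingP/uN.
have /existsNP[B hB] : ~ forall B : 'M[C]_(k, n),
  v.@[fun i => minor B (enum_val i)] = 0 by move/vanishingP/vN.
pose M : 'M[{poly C}]_(k, n) :=
  map_mx polyC A + 'X *: map_mx polyC (B - A).
pose P (f : {mpoly C[N]}) := mmap polyC (fun i => minor M (enum_val i)) f.
have PE f t : (P f).[t] =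
    f.@[fun i => minor (A + t *: (B - A)) (enum_val i)].
  rewrite /P mevalE /mmap -horner_evalE rmorph_sum; apply: eq_bigr => m _.
  rewrite rmorphM /= {1}/horner_eval hornerC; congr (_ * _).
  rewrite rmorph_prod; apply: eq_bigr => i _; rewrite rmorphXn; congr (_ ^+ _).
  rewrite /= /minor -det_map_mx; congr (\det _); apply/matrixP => a b.
  by rewrite !mxE -[LHS]/((_ + _).[t]) !hornerE.
have uv0 : P u * P v = 0.
  by apply: poly_eval0 => t; rewrite hornerM !PE -mevalM huv.
have /eqP : P u * P v = 0 by [].
rewrite mulf_eq0 => /orP[] /eqP P0.
  by apply: hA; have := PE u 0; rewrite P0 horner0 scale0r addr0 => <-.
apply: hB; have := PE v 1; rewrite P0 horner0 scale1r.
by rewrite [A + _]addrC subrK => <-.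
Qed.

HB.instance Definition _ := isIdealr.Build {mpoly C[N]} vanishing
  vanishing_idealr.
HB.instance Definition _ := isPrimeIdealrClosed.Build {mpoly C[N]} vanishing
  vanishing_prime.

Definition coord_ring : Type := {ideal_quot vanishing}.

HB.instance Definition _ := GRing.ComNzRing.on coord_ring.

(* A classical inverse, as [tofrac] expects an integral domain whose units have
   an inverse function. *)
Definition coord_unit : {pred coord_ring} := fun x => `[< exists y, y * x = 1 >].

Definition coord_inv (x : coord_ring) : coord_ring :=
  if pselect (exists y, y * x = 1) is left e then projT1 (cid e) else x.

Lemma coord_mulVr : {in coord_unit, left_inverse 1 coord_inv *%R}.
Proof.
move=> x /asboolP xU; rewrite /coord_inv; case: pselect => // e.
by case: (cid e).
Qed.

Lemma coord_unitP (x y : coord_ring) : y * x = 1 -> x \in coord_unit.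
Proof. by move=> xy; apply/asboolP; exists y. Qed.

Lemma coord_inv_out : {in [predC coord_unit], coord_inv =1 id}.
Proof.
move=> x /asboolP xNU; rewrite /coord_inv; case: pselect => // e.
Qed.

HB.instance Definition _ := GRing.ComNzRing_hasMulInverse.Build coord_ring
  coord_mulVr coord_unitP coord_inv_out.

HB.instance Definition _ := GRing.ComUnitRing_isIntegral.Build coord_ring
  (@Quotient.rquot_IdomainAxiom _ vanishing).

Definition coord_class : {mpoly C[N]} -> coord_ring := \pi_coord_ring%qT.

HB.instance Definition _ := GRing.RMorphism.on coord_class.

Definition func_field : fieldType := {fraction coord_ring}.

Definition coord_const : C -> func_field :=
  @tofrac coord_ring \o coord_class \o @mpolyC N C.

HB.instance Definition _ := GRing.RMorphism.on coord_const.

(* The Pluecker coordinate on K; 0 is a junk value for #|K| <> k. *)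
Definition plucker (K : {set 'I_n}) : coord_ring :=
  if insub K is Some K' then coord_class 'X_(enum_rank (K' : ksubset k n))
  else 0.

End Grassmannian.

Section XY.
Variables (C : numFieldType) (n : nat) (a : 'I_6 -> 'I_n).

(* For a increasing, composition with a is the pullback along the projection
   G(3, n) -> G(3, 6) keeping the columns a_1 < ... < a_6, a_r being the value
   of a at r - 1. When n = 7, [lift i] is the increasing enumeration of the
   complement of i. *)
Let D (r s t : nat) : coord_ring C 3 n :=
  plucker C 3 [set a (inord r.-1); a (inord s.-1); a (inord t.-1)]%SET.

Definition quadX := D 1 3 4 * D 2 5 6 - D 1 5 6 * D 2 3 4.
Definition quadY := D 1 4 5 * D 2 3 6 - D 1 2 3 * D 4 5 6.

End XY.

(* The column labelled r in {1, ..., n} is r - 1 : 'I_n. *)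

Section InitialSeed.
Variables (C : numFieldType) (k n : nat).

Definition cyclic_interval (a : 'I_n) : {set 'I_n} :=
  [set x : 'I_n | [exists b : 'I_k, x == a + b %[mod n]]]%SET.

Definition internal (K : {set 'I_n}) : bool :=
  (#|K| == k) && ~~ [exists a, K == cyclic_interval a].

(* [divz] by 2 is the floor. *)
Definition I_set (i j : nat) : {set 'I_n} :=
  let p : int := n%:Z - k%:Z - ((i%:Z + j%:Z - 2) %/ 2)%Z in
  let p' : int := n%:Z - k%:Z + 2 + ((i%:Z + j%:Z - 1) %/ 2)%Z in
  [set x : 'I_n |
      [exists a : 'I_i, (x.+1%:Z == p + a%:Z %[mod n%:Z])%Z]
   || [exists b : 'I_(k - i), (x.+1%:Z == p' + b%:Z %[mod n%:Z])%Z]]%SET.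

(* The pairs (i, j) with 1 <= i <= k - 1 and 1 <= j <= n - k - 1, shifted by 1. *)
Definition mut_index : finType := ('I_k.-1 * 'I_(n - k).-1)%type.

Definition mut_set (c : mut_index) : {set 'I_n} := I_set c.1.+1 c.2.+1.

Definition row_set (r : mut_index + 'I_n) : {set 'I_n} :=
  match r with inl c => mut_set c | inr a => cyclic_interval a end.

Definition initial_exch (r : mut_index + 'I_n) (c : mut_index) : int :=
  let i := c.1.+1 in
  let j := c.2.+1 in
  if row_set r \in [:: I_set i.+1 j; I_set i.-1 j] then (-1) ^+ (i + j)
  else if row_set r \in [:: I_set i j.+1; I_set i j.-1] then - (-1) ^+ (i + j)
  else 0.

Definition initial_seed : preseed (func_field C k n) mut_index 'I_n :=
  {| cluster := fun c => tofrac (plucker C k (mut_set c));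
     coefs := fun a => tofrac (plucker C k (cyclic_interval a));
     exch := initial_exch |}.

Definition grassmannian_cluster_variables : set (func_field C k n) :=
  cluster_variables (@coord_const C k n) initial_seed.

End InitialSeed.

Arguments grassmannian_cluster_variables C k n : clear implicits.

(* Main.v *)
From HB Require Import structures.
Require Import Defs.
From Stdlib Require BinInt BinNums BinNat BinPos BinList.
From Stdlib Require Ring_polynom Ring_theory.
From mathcomp Require Import ssrZ ring.

(** The cluster structure has finite type E6: up to the labels of the cluster
    variables there are finitely many seeds, namely 833, and the proof runs
    through all of them.  The 28 internal Pluecker coordinates and the 14
    quadratic functions are numbered from 0 to 41, and the seven coefficients
    from 42 to 48 ([cvar_formula]), so that a seed becomes a list of numbers,
    each with its column of the exchange matrix.  A breadth-first search over
    these lists produces the table [seeds].  It recognises the new variable of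
    an exchange by its value at one integer matrix where the 42 functions take
    distinct values; no property of the search itself enters the proof.

    Two finite verifications turn the table into a theorem.  By
    [relations_ok], every exchange relation z z' = M + M' of the table is an
    identity between integer polynomials in the 21 entries of a 3 x 7 matrix.
    As a regular function on the cone is determined by its values at matrices
    ([ev_inj]), the relation holds in the coordinate ring.  By [seeds_ok], the
    table is closed under mutation.  Hence every labelled seed obtained from
    the initial one is a labelling of a table entry ([labelling_mutate]), and
    its cluster variables are among the 42 functions.  Conversely the table is
    connected ([seeds_connected]), so that all its entries are reached, and
    each of the 42 functions occurs in one of them ([seeds_cover]).  These
    functions are distinct because they differ at the integer matrix.

    The mutation class is empty unless the initial data form a seed, which is
    the remaining point ([initial_is_seed]).  The thirteen initial functions
    are algebraically independent because thirteen arbitrary nonzero numbers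
    are their values at some matrix ([exists_matrix_with_minors]), while a
    polynomial that vanishes at all points with nonzero coordinates is zero.
    They form a maximal independent family because they generate the field:
    every Pluecker coordinate is a cluster variable or a coefficient, hence a
    rational function of the initial ones, and an element of the field
    generated by a family depends algebraically on it
    ([rational_dependent]). *)

Set Implicit Arguments.
Unset Strict Implicit.
Unset Printing Implicit Defensive.

Import Order.TTheory GRing.Theory Num.Theory.
Local Open Scope nat_scope.

Notation Z := BinNums.Z.
Notation Z0 := BinNums.Z0.
Notation Z1 := (BinNums.Zpos BinNums.xH).
Module Z := BinInt.Z.

(** * Formulas over several carriers *)

(** The same formulas are read in the coordinate ring and the function field,
    where they are statements, in Z, where they are evaluated at a sample
    matrix, and in sparse integer polynomials, where identities are decided by
    computation.  These polynomials are plain data that satisfy the laws of a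
    ring only up to normalisation, hence a record of operations instead of a
    ring structure. *)
Record ops (T : Type) := Ops {
  one : T; add : T -> T -> T; sub : T -> T -> T; mul : T -> T -> T }.

Definition ring_ops (R : comNzRingType) : ops R :=
  Ops 1%R +%R (fun x y => x - y)%R *%R.

Definition Z_ops : ops Z := Ops Z1 Z.add Z.sub Z.mul.
Definition Zpoly := Ring_polynom.Pol Z.
Definition Zpoly_ops : ops Zpoly :=
  Ops (Ring_polynom.Pc Z1) (Ring_polynom.Padd Z0 Z.add Z.eqb)
    (Ring_polynom.Psub Z0 Z.add Z.sub Z.opp Z.eqb)
    (Ring_polynom.Pmul Z0 Z1 Z.add Z.mul Z.eqb).
Definition ops_morphism T T' (o : ops T) (o' : ops T') (h : T -> T') : Prop :=
  [/\ h (one o) = one o', {morph h : x y / add o x y >-> add o' x y},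
      {morph h : x y / sub o x y >-> sub o' x y} &
      {morph h : x y / mul o x y >-> mul o' x y}].

Lemma rmorph_ops (R S : comNzRingType) (h : {rmorphism R -> S}) :
  ops_morphism (ring_ops R) (ring_ops S) h.
Proof.
by split; [exact: rmorph1 | exact: rmorphD | exact: rmorphB | exact: rmorphM].
Qed.

Section Zpoly.
Variable R : comNzRingType.

Definition ofZ (z : Z) : R := (ssrZ.int_of_Z z)%:~R.

Lemma ofZ_ops : ops_morphism Z_ops (ring_ops R) ofZ.
Proof.
split=> [|x y|x y|x y]; rewrite /ofZ //=.
- by rewrite -rmorphD -(rmorphD ssrZ.int_of_Z).
- by rewrite -rmorphB -(rmorphB ssrZ.int_of_Z).
- by rewrite -rmorphM -(rmorphM ssrZ.int_of_Z).
Qed.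

Variable l : seq R.
Definition Zpoly_eval : Zpoly -> R :=
  Ring_polynom.Pphi 0%R +%R *%R ofZ l.
Let op_sub (x y : R) : R := (x - y)%R.
Let R_equiv : RelationClasses.Equivalence (@eq R) :=
  RelationClasses.eq_equivalence.
Let R_ext := Ring_theory.Eq_ext (@GRing.add R) *%R -%R%R.
Let R_theory : Ring_theory.almost_ring_theory 0%R 1%R +%R *%R op_sub -%R%R
  (@eq R).
Proof.
apply: (Ring_theory.Rth_ARth R_equiv R_ext); split=> //.
- exact: add0r.
- exact: addrC.
- exact: addrA.
- exact: mul1r.
- exact: mulrC.
- exact: mulrA.
- exact: mulrDl.
- exact: subrr.
Qed.
Let Z_morph : Ring_theory.ring_morph 0%R 1%R +%R *%R op_sub -%R%R (@eq R)
  Z0 Z1 Z.add Z.mul Z.sub Z.opp Z.eqb ofZ.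
Proof.
have [h1 hD hB hM] := ofZ_ops; split=> // [x|x y /BinInt.Z.eqb_eq -> //].
by have := hB Z0 x; rewrite /= /ofZ sub0r.
Qed.

(** Soundness of the computation with polynomials in Horner form: it commutes
    with evaluation in any commutative ring. *)
Lemma Zpoly_eval_ops : ops_morphism Zpoly_ops (ring_ops R) Zpoly_eval.
Proof.
split=> [|x y|x y|x y] //=.
- exact: (Ring_polynom.Padd_ok R_equiv R_ext R_theory Z_morph).
- exact: (Ring_polynom.Psub_ok R_equiv R_ext R_theory Z_morph).
- exact: (Ring_polynom.Pmul_ok R_equiv R_ext R_theory Z_morph).
Qed.

Definition Zpoly_var i : Zpoly :=
  Ring_polynom.mk_X Z0 Z1 (BinPos.Pos.of_succ_nat i).

Lemma Zpoly_eval_var i : Zpoly_eval (Zpoly_var i) = nth 0%R l i.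
Proof.
rewrite -[LHS](Ring_polynom.mkX_ok R_equiv R_ext R_theory Z_morph).
have jumpE j (m : seq R) :
    BinList.jump (BinPos.Pos.of_succ_nat j) m = drop j.+1 m.
  elim: j m => [|j IH] [|x m] //=; rewrite ?drop0 // BinList.jump_succ IH //.
  by rewrite -[LHS]/(behead _) -drop1 drop_drop.
rewrite -[l in LHS]/(List.tl (0%R :: l)) BinList.nth_jump jumpE /=.
by rewrite -[i in RHS]addn0 -nth_drop; case: (drop i l).
Qed.

Lemma Zpoly_eval_eq (p q : Zpoly) :
  Ring_polynom.Peq Z.eqb p q -> Zpoly_eval p = Zpoly_eval q.
Proof. by move=> h; apply: (Ring_polynom.Peq_ok R_equiv R_ext Z_morph). Qed.
End Zpoly.

Local Open Scope ring_scope.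

(** * Regular functions as functions of a matrix *)

Section Evaluation.
Variables (C : numFieldType) (k n : nat) (A : 'M[C]_(k, n)).

(** The value of a regular function at the point of the cone given by the rows
    of [A]; the choice of a representing polynomial is immaterial. *)
Definition ev (x : coord_ring C k n) : C :=
  (repr x).@[fun i => minor A (enum_val i)].

Lemma ev_class p : ev (coord_class p) = p.@[fun i => minor A (enum_val i)].
Proof.
have /vanishingP/(_ A) : repr (coord_class p) - p \in @vanishing C k n.
  by rewrite Quotient.idealrBE reprK.
by rewrite mevalB => /eqP; rewrite subr_eq0 => /eqP.
Qed.

Lemma ev_is_zmod_morphism : zmod_morphism ev.
Proof.
move=> x y; rewrite -[x]reprK -[y]reprK.
by rewrite -[_ - _](rmorphB (@coord_class C k n)) !ev_class mevalB.
Qed.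

Lemma ev_is_monoid_morphism : monoid_morphism ev.
Proof.
split; first by rewrite -(rmorph1 (@coord_class C k n)) ev_class meval1.
move=> x y; rewrite -[x]reprK -[y]reprK.
by rewrite -[_ * _](rmorphM (@coord_class C k n)) !ev_class mevalM.
Qed.

HB.instance Definition _ :=
  GRing.isZmodMorphism.Build (coord_ring C k n) C ev ev_is_zmod_morphism.
HB.instance Definition _ :=
  GRing.isMonoidMorphism.Build (coord_ring C k n) C ev ev_is_monoid_morphism.

Lemma ev_plucker (K : ksubset k n) : ev (plucker C k (val K)) = minor A K.
Proof. by rewrite /plucker valK ev_class mevalXU enum_rankK. Qed.

End Evaluation.

(** The ideal of the cone consists of the polynomials that vanish at all
    decomposable forms, so that evaluations separate its regular functions.
    All identities in the coordinate ring are proved through this lemma. *)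
Lemma ev_inj (C : numFieldType) k n (x y : coord_ring C k n) :
  (forall A, ev A x = ev A y) -> x = y.
Proof.
move=> h; rewrite -[x]reprK -[y]reprK; apply/eqP.
rewrite -Quotient.idealrBE; apply/vanishingP => A.
by rewrite mevalB; apply/eqP; rewrite subr_eq0; apply/eqP; apply: h.
Qed.

(** * Polynomials that vanish off the coordinate hyperplanes *)

Section NonVanishing.
Variable C : numFieldType.
Local Notation widen := (widen_ord (leqnSn _)).

Lemma horner_muni n (v : 'I_n -> C) (t : C) (p : {mpoly C[n.+1]}) :
  (map_poly (meval v) (muni p)).[t] = p.@[fun i => oapp v t (insub (val i))].
Proof.
rewrite muniE mevalE rmorph_sum -horner_evalE rmorph_sum; apply: eq_bigr => m _.
rewrite /= /horner_eval -!mul_polyC !rmorphM /= !map_polyC /= map_polyXn.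
rewrite !hornerE mevalZ mevalX big_ord_recr insubN ?ltnn //= mulrA.
congr (_ * _ * _); apply: eq_bigr => i _; rewrite mnmE.
rewrite (insubT (fun x => (x < n)%N) (ltn_ord i)) /=.
by congr (v _ ^+ _); apply: val_inj.
Qed.

Lemma muni_eq0 n (p : {mpoly C[n.+1]}) : muni p = 0 -> p = 0.
Proof.
move=> p0; apply/mpolyP => m; rewrite mcoeff0.
have := congr1 (fun q : {poly {mpoly C[n]}} =>
  mcoeff [multinom m (widen i) | i < n] q`_(m ord_max)) p0.
rewrite coef0 mcoeff0 muniE coef_sum raddf_sum /= => <-.
rewrite [p in LHS]mpolyE raddf_sum /=; apply: eq_bigr => m' _.
rewrite coefZ coefXn mcoeffZ mcoeffX -scalerAl mcoeffZ; congr (_ * _).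
have -> : (m' == m) = (m' ord_max == m ord_max) &&
   ([multinom m' (widen i) | i < n] == [multinom m (widen i) | i < n]).
  apply/eqP/andP => [->|[/eqP e /eqP/mnmP e']]; first by [].
  apply/mnmP => i; have [j ->|->] := unliftP ord_max i; last by [].
  have := e' j; rewrite !mnmE; have -> //: widen j = lift ord_max j.
  by apply: val_inj; rewrite /= /bump leqNgt ltn_ord.
rewrite [m ord_max == _]eq_sym; case: (_ ord_max == _) => /=.
  by rewrite mulr1 mcoeffX.
by rewrite mulr0 mcoeff0.
Qed.

(** Induction on the number of variables: as a polynomial in the last variable
    with the other ones fixed, [p] vanishes at all nonzero arguments.  Only
    points with nonzero coordinates are used because the matrix with prescribed
    minors constructed below divides by some of these minors. *)
Lemma mpoly_eq0_nonzero_points n (p : {mpoly C[n]}) :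
  (forall c, (forall i, c i != 0) -> p.@[c] = 0) -> p = 0.
Proof.
elim: n p => [|n IH] p p0.
  have := p0 (fun=> 1) (fun=> oner_neq0 _).
  by rewrite [p]nvar0_mpolyC mevalC => ->; rewrite mpolyC0.
apply: muni_eq0; apply/polyP => i; rewrite coef0; apply: IH => v v0.
rewrite -coef_map /=; suff -> : map_poly (meval v) (muni p) = 0 by rewrite coef0.
have h t : t != 0 -> (map_poly (meval v) (muni p)).[t] = 0.
  by move=> t0; rewrite horner_muni; apply: p0 => j; case: insub.
have /eqP : map_poly (meval v) (muni p) * 'X = 0.
  apply: poly_eval0 => t; rewrite hornerM hornerX.
  by have [->|/h->] := eqVneq t 0; rewrite ?mulr0 ?mul0r.
by rewrite mulf_eq0 polyX_eq0 orbF => /eqP.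
Qed.
End NonVanishing.

(** * Families that generate a field of rational functions *)

Section RationalIn.
Variables (C F : fieldType) (iota : {rmorphism C -> F}) (T : finType) (x : T -> F).

Local Notation at_x := (mmap iota (x \o enum_val)).

Definition rational_in (f : F) : Prop :=
  exists g h : {mpoly C[#|T|]}, at_x h != 0 /\ f * at_x h = at_x g.

Lemma rational_const a : rational_in (iota a).
Proof. by exists a%:MP, 1; rewrite rmorph1 oner_neq0 mulr1 mmapC. Qed.

Lemma rational_gen t : rational_in (x t).
Proof.
exists 'X_(enum_rank t), 1.
by rewrite rmorph1 oner_neq0 mulr1 mmapX mmap1U /= enum_rankK.
Qed.

Lemma rationalD f1 f2 :
  rational_in f1 -> rational_in f2 -> rational_in (f1 + f2).
Proof.
move=> [g1 [h1 [h1N e1]]] [g2 [h2 [h2N e2]]].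
exists (g1 * h2 + g2 * h1), (h1 * h2).
rewrite rmorphD !rmorphM /= mulf_neq0 // -e1 -e2; split=> //; ring.
Qed.

Lemma rationalM f1 f2 :
  rational_in f1 -> rational_in f2 -> rational_in (f1 * f2).
Proof.
move=> [g1 [h1 [h1N e1]]] [g2 [h2 [h2N e2]]].
exists (g1 * g2), (h1 * h2).
by rewrite !rmorphM /= mulf_neq0 // -e1 -e2 mulrACA.
Qed.

Lemma rationalV f : rational_in f -> rational_in f^-1.
Proof.
move=> [g [h [hN e]]]; have [->|fN0] := eqVneq f 0.
  by rewrite invr0 -(rmorph0 iota); apply: rational_const.
by exists h, g; rewrite -e mulf_neq0 // mulKf.
Qed.

Lemma rationalX f m : rational_in f -> rational_in (f ^+ m).
Proof.
move=> fR; elim: m => [|m IH]; last by rewrite exprS; apply: rationalM.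
by rewrite expr0 -(rmorph1 iota); apply: rational_const.
Qed.

Lemma rational_prod (I : Type) (r : seq I) (P : pred I) (f : I -> F) :
  (forall i, P i -> rational_in (f i)) -> rational_in (\prod_(i <- r | P i) f i).
Proof.
move=> fR; apply: big_ind => //; last exact: rationalM.
by rewrite -(rmorph1 iota); apply: rational_const.
Qed.

Lemma rational_mmap m (v : 'I_m -> F) (p : {mpoly C[m]}) :
  (forall i, rational_in (v i)) -> rational_in (mmap iota v p).
Proof.
move=> vR; rewrite /mmap; apply: big_ind => [||mm _].
- by rewrite -(rmorph0 iota); apply: rational_const.
- exact: rationalD.
apply: rationalM; first exact: rational_const.
by apply: rational_prod => i _; apply: rationalX.
Qed.

(** If y = g(x) / h(x), then h(x) Y - g(x) is a polynomial relation satisfied by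
    Y = y.  It is not the zero polynomial: otherwise h u = g for every
    polynomial u, and u = 0, 1 give h = 0. *)
Lemma rational_dependent y :
  rational_in y -> ~ algebraically_independent iota (oapp x y).
Proof.
move=> [g [h [hN e]]] indep; pose T' : finType := option T.
pose w : 'I_#|T| -> {mpoly C[#|T'|]} :=
  fun i => 'X_(enum_rank (Some (enum_val i) : T')).
pose up := mmap (@mpolyC _ C) w.
pose z : {mpoly C[#|T'|]} := 'X_(enum_rank (None : T')).
have at_up q : mmap iota (oapp x y \o enum_val) (up q) = at_x q.
  rewrite [up q]/mmap rmorph_sum; apply: eq_bigr => m _.
  rewrite rmorphM /= mmapC /mmap1; congr (_ * _).
  rewrite rmorph_prod; apply: eq_bigr => i _.
  by rewrite rmorphXn /= mmapX mmap1U /= enum_rankK.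
have p0 : up h * z - up g = 0.
  apply: indep; rewrite rmorphB rmorphM /= !at_up mmapX mmap1U /= enum_rankK /=.
  by rewrite -e mulrC subrr.
(* Left inverse of [up] that substitutes u for Y. *)
pose down (u : {mpoly C[#|T|]}) : {mpoly C[#|T'|]} -> {mpoly C[#|T|]} :=
  mmap (@mpolyC _ C)
    (fun i => oapp (fun t => 'X_(enum_rank t)) u (enum_val i : T')).
have down_up u q : down u (up q) = q.
  rewrite [in RHS](mpolyE q) [up q]/mmap /down rmorph_sum; apply: eq_bigr => m _.
  rewrite rmorphM /= mmapC /mmap1 -mul_mpolyC mpolyXE_id; congr (_ * _).
  rewrite rmorph_prod; apply: eq_bigr => i _.
  by rewrite rmorphXn /= mmapX mmap1U /= enum_rankK /= enum_valK.
have down_p u : h * u = g.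
  have down_z : down u z = u by rewrite /down mmapX mmap1U /= enum_rankK.
  apply/eqP; rewrite -subr_eq0 -(down_up u h) -{2}down_z -(down_up u g).
  by rewrite /down -rmorphM -rmorphB p0 rmorph0.
case/eqP: hN; rewrite -[h]mulr1 (down_p 1) -(down_p 0) mulr0; exact: rmorph0.
Qed.

End RationalIn.

Lemma tofrac_fraction (R : idomainType) (f : {fraction R}) :
  exists a b : R, f = tofrac a / tofrac b.
Proof.
exists (repr f).1, (repr f).2; have rN := denom_ratioP (repr f).
have dN : tofrac (repr f).2 != 0 by rewrite tofrac_eq0.
apply: (canRL (mulfK dN)); rewrite -{1}[f]reprK; unlock FracField.tofrac.
rewrite -[LHS]FracField.pi_mul; apply/eqmodP; rewrite /= FracField.equivfE.
by rewrite /FracField.mulf !numden_Ratio ?mulf_neq0 ?oner_neq0 // !mulr1 mulrC.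
Qed.

Local Open Scope nat_scope.
(** * Triples of columns and their minors *)

Definition interval a : seq nat := sort leq [seq (a + i) %% 7 | i <- iota 0 3].
Definition triples : seq (seq nat) :=
  let pairs := [seq [:: b; c] | b <- iota 0 7, c <- iota 0 7] in
  [seq s <- [seq a :: s | a <- iota 0 7, s <- pairs] | sorted ltn s].
Definition intervals : seq (seq nat) := [seq interval a | a <- iota 0 7].
Definition internals := [seq s <- triples | s \notin intervals].

Definition det3 (T : Type) (o : ops T) (f : nat -> nat -> T) (s : seq nat) : T :=
  let a i := f i (nth 0 s 0) in
  let b i := f i (nth 0 s 1) in
  let c i := f i (nth 0 s 2) in
  let det2 i j := sub o (mul o (b i) (c j)) (mul o (b j) (c i)) in
  add o (sub o (mul o (a 0) (det2 1 2)) (mul o (a 1) (det2 0 2)))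
    (mul o (a 2) (det2 0 1)).

(** Sets of columns are handled as increasing lists of numbers, which compute;
    the column labelled r + 1 in the usual notation is r. *)
Definition column_set (s : seq nat) : {set 'I_7} := [set x : 'I_7 | (x : nat) \in s].

Lemma triplesP s : reflect
  (exists a b c, [/\ s = [:: a; b; c], a < b, b < c & c < 7]) (s \in triples).
Proof.
rewrite mem_filter; apply: (iffP andP).
  move=> [s_sorted /allpairsPdep[a [t [a7 /allpairsPdep[b [c [b7 c7 ->]]] es]]]].
  move: s_sorted c7; rewrite es mem_iota /= andbT => /andP[ab bc] c7.
  by exists a, b, c.
move=> [a [b [c [-> ab bc c7]]]]; have b7 := ltn_trans bc c7.
split; first by rewrite /= ab bc.
apply: allpairs_f; first by rewrite mem_iota (ltn_trans ab b7).
by apply: allpairs_f; rewrite mem_iota.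
Qed.

Lemma enum_column_set s :
  s \in triples -> enum (column_set s) = [seq inord x | x <- s].
Proof.
move=> /triplesP[a [b [c [-> ab bc c7]]]]; have b7 := ltn_trans bc c7.
have a7 := ltn_trans ab b7; apply: (inj_map val_inj).
rewrite -map_comp; apply: (@irr_sorted_eq _ ltn ltn_trans ltnn).
- rewrite /enum_mem -enumT; apply: (subseq_sorted ltn_trans _ (iota_ltn_sorted 0 7)).
  by rewrite -val_enum_ord; apply: map_subseq; apply: filter_subseq.
- by rewrite /= !inordK // ab bc.
move=> x; apply/mapP/idP => [[y]|].
  rewrite mem_enum inE => + ->; by rewrite /= !inordK.
rewrite /= !inordK // => xs.
have x7 : x < 7 by move: xs; rewrite !inE => /or3P[] /eqP->.
exists (inord x); last by rewrite inordK.
by rewrite mem_enum /column_set inE inordK.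
Qed.

Lemma column_set_inj : {in triples &, injective column_set}.
Proof.
move=> s t sT tT e; have := enum_column_set sT; rewrite e enum_column_set // => e'.
have K u : u \in triples -> map (@nat_of_ord 7) (map inord u) = u.
  move=> /triplesP[a [b [c [-> ab bc c7]]]]; have b7 := ltn_trans bc c7.
  by rewrite /= !inordK // (ltn_trans ab b7).
by rewrite -[s]K // -e' K.
Qed.

Lemma card_column_set s : s \in triples -> #|column_set s| == 3.
Proof.
move=> sT; rewrite cardE enum_column_set // size_map.
by case/triplesP: sT => a [b [c [->]]].
Qed.

Lemma column_set_surj (K : {set 'I_7}) :
  #|K| = 3 -> exists2 s, s \in triples & K = column_set s.
Proof.
move=> K3; pose s := map (@nat_of_ord 7) (enum K).
have sT : s \in triples.
  have : size s = 3 by rewrite size_map -cardE.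
  have : sorted ltn s.
    rewrite /s /enum_mem -enumT.
    apply: (subseq_sorted ltn_trans _ (iota_ltn_sorted 0 7)).
    by rewrite -val_enum_ord; apply: map_subseq; apply: filter_subseq.
  have : all (fun x => x < 7) s by apply/allP => x /mapP[y _ ->].
  case: s => [|a [|b [|c []]]] //= /and4P[_ _ c7 _] /and3P[ab bc _] _.
  by apply/triplesP; exists a, b, c.
exists s => //; apply/setP => x; rewrite inE mem_map ?mem_enum //.
exact: val_inj.
Qed.

Lemma minor_column_set (R : comNzRingType) (A : 'M[R]_(3, 7)) s
    (sT : s \in triples) :
  minor A (Sub (column_set s) (card_column_set sT) : ksubset 3 7) =
  det3 (ring_ops R) (fun i j => A (inord i) (inord j)) s.
Proof.
rewrite /minor; set M := colsub _ A.
have E i j : M i j = A (inord i) (inord (nth 0 s j)).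
  rewrite mxE inord_val /ksubset_val (enum_val_nth (inord 0)) /= enum_column_set //.
  rewrite (nth_map 0) //.
  by have /triplesP[a [b [c [->]]]] := sT.
move: M E => M E.
rewrite (expand_det_col _ ord0) !big_ord_recl big_ord0 /cofactor.
rewrite !(expand_det_col _ ord0) !big_ord_recl !big_ord0 /cofactor !det_mx11.
by rewrite !mxE !E /bump /= /det3; ring.
Qed.

Definition entries (R : comNzRingType) (A : 'M[R]_(3, 7)) (i j : nat) : R :=
  A (inord i) (inord j).

Lemma ev_column_set (C : numFieldType) (A : 'M[C]_(3, 7)) : {in triples, forall s,
  ev A (plucker C 3 (column_set s)) = det3 (ring_ops C) (entries A) s}.
Proof. by move=> s sT; rewrite -(minor_column_set A sT) -ev_plucker. Qed.

Lemma det3_morph T T' (o : ops T) (o' : ops T') h f s : ops_morphism o o' h ->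
  h (det3 o f s) = det3 o' (fun i j => h (f i j)) s.
Proof. by case=> _ hD hB hM; rewrite /det3 hD hB !hM !hB !hM. Qed.

Lemma det3_eq T (o : ops T) f g s : s \in triples ->
    (forall i j, i < 3 -> j < 7 -> f i j = g i j) ->
  det3 o f s = det3 o g s.
Proof.
move=> /triplesP[a [b [c [-> ab bc c7]]]] fg; have b7 := ltn_trans bc c7.
by rewrite /det3 /= !fg // (ltn_trans ab b7).
Qed.

(** * The forty-two functions and the seven coefficients *)

(** In terms of the minors [D]: numbers below 28 are the internal triples in
    lexicographic order, 28 + i and 35 + i are X and Y on the complement of the
    column i, and 42 + a is the cyclic interval starting at a.  As [bump i]
    enumerates the complement of i in increasing order, all triples below are
    increasing. *)
Definition cvar_formula (T : Type) (o : ops T) (D : seq nat -> T) (d : nat) : T :=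
  let D6 i r s t := D [:: bump i r.-1; bump i s.-1; bump i t.-1] in
  if d < 28 then D (nth [::] internals d)
  else if d < 35 then
    let D' := D6 (d - 28) in
    sub o (mul o (D' 1 3 4) (D' 2 5 6)) (mul o (D' 1 5 6) (D' 2 3 4))
  else if d < 42 then
    let D' := D6 (d - 35) in
    sub o (mul o (D' 1 4 5) (D' 2 3 6)) (mul o (D' 1 2 3) (D' 4 5 6))
  else D (nth [::] intervals (d - 42)).

Lemma bump_triple i r s t :
  i < 7 -> r < s -> s < t -> t < 6 -> [:: bump i r; bump i s; bump i t] \in triples.
Proof.
move=> i7 rs st t6; apply/triplesP; exists (bump i r), (bump i s), (bump i t).
have ltb x y : x < y -> bump i x < bump i y by rewrite !ltnNge leq_bump2.
rewrite !ltb //; split=> //; rewrite /bump.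
by case: (i <= t); [apply: leq_ltn_trans t6 | apply: ltnW].
Qed.

Lemma internals_triple d : d < 28 -> nth [::] internals d \in triples.
Proof.
move=> d28; have := @mem_nth _ [::] internals d d28.
by rewrite mem_filter => /andP[].
Qed.

Lemma intervals_triple a : a < 7 -> nth [::] intervals a \in triples.
Proof. by do 7![case: a => [//|a]]. Qed.

Lemma cvar_formula_morph T T' (o : ops T) (o' : ops T') h D D' d : d < 49 ->
    ops_morphism o o' h -> {in triples, forall s, h (D s) = D' s} ->
  h (cvar_formula o D d) = cvar_formula o' D' d.
Proof.
move=> d49 [_ _ hB hM] hD; rewrite /cvar_formula.
case: ltnP => [d28|d28]; first by rewrite hD ?internals_triple.
case: ltnP => [d35|d35].
  have i7 : d - 28 < 7 by rewrite ltn_subLR.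
  by rewrite hB !hM !hD // bump_triple.
case: ltnP => [d42|d42].
  have i7 : d - 35 < 7 by rewrite ltn_subLR.
  by rewrite hB !hM !hD // bump_triple.
by rewrite hD // intervals_triple // ltn_subLR.
Qed.

(** The nonzero entries of a column of the exchange matrix, indexed by the
    numbers of the rows. *)
Definition column := seq (nat * int).

Definition exch_rhs (T : Type) (o : ops T) (v : nat -> T) (c : column) : T :=
  let monomial P := foldr (fun e t =>
    if P e.2 then iter `|e.2| (mul o (v e.1)) t else t) (one o) c in
  add o (monomial (fun a => 0 < a)%R) (monomial (fun a => a < 0)%R).

Lemma exch_rhs_morph T T' (o : ops T) (o' : ops T') h v v' (c : column) :
    ops_morphism o o' h -> {in unzip1 c, forall x, h (v x) = v' x} ->
  h (exch_rhs o v c) = exch_rhs o' v' c.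
Proof.
move=> [h1 hD _ hM] hv; rewrite /exch_rhs hD.
congr (add o' _ _); elim: c hv => [//|[x a] c IH] hv /=.
all: have {}IH := IH (fun y yc => hv y (@mem_behead _ (x :: unzip1 c) y yc)).
all: case: ifP => _ //.
all: elim: `|a| => [|m IHm] /=; rewrite ?hM ?IHm ?hv ?mem_head //.
Qed.

(** The matrix with columns (1, j^3, j^4) for j = 0, ..., 6.  The 42 functions
    take distinct nonzero values there, which fails for the plain powers
    (1, j, j^2), whose minors depend on the differences of the j only. *)
Definition sample (i j : nat) : Z :=
  Z.pow (Z.of_nat j) (Z.of_nat (nth 0 [:: 0; 3; 4] i)).
Definition sample_value (d : nat) : Z := cvar_formula Z_ops (det3 Z_ops sample) d.

(** * Unlabelled seeds *)

(** For each cluster variable, its number, the number of the variable that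
    replaces it under mutation, and its column of the exchange matrix. *)
Definition unlabelled_seed := seq (nat * (nat * column)).

Fixpoint coef (c : column) (x : nat) : int :=
  if c is (y, a) :: c' then if eqn y x then a else coef c' x else 0%R.

Fixpoint exchange (s : unlabelled_seed) (y : nat) : nat * column :=
  if s is (z, e) :: s' then if eqn z y then e else exchange s' y
  else (0, [::]).

Definition ids (s : unlabelled_seed) : seq nat := unzip1 s.
Definition rows (s : unlabelled_seed) : seq nat := ids s ++ iota 42 7.
Definition entry (s : unlabelled_seed) (x y : nat) : int := coef (exchange s y).2 x.

(** [I_set] for columns numbered from 0.  The starting points are p - 1 + 7 and
    p' - 1, with the integer halves of i + j - 2 and i + j - 1 written as those
    of i + j and i + j + 1, minus one, so that natural numbers suffice. *)
Definition I_list (i j : nat) : seq nat :=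
  sort leq ([seq (11 - (i + j)./2 + a) %% 7 | a <- iota 0 i]
         ++ [seq (4 + uphalf (i + j) + b) %% 7 | b <- iota 0 (3 - i)]).

Definition triple_id (s : seq nat) : nat :=
  if s \in internals then index s internals else 42 + index s intervals.

Definition exch0 (s : seq nat) (i j : nat) : int :=
  if s \in [:: I_list i.+1 j; I_list i.-1 j] then ((-1) ^+ (i + j))%R
  else if s \in [:: I_list i j.+1; I_list i j.-1] then (- (-1) ^+ (i + j))%R
  else 0%R.

Definition grid : seq (nat * nat) := [seq (i, j) | i <- iota 1 2, j <- iota 1 3].

(** * Enumeration of the seeds *)

Definition sample_values : seq Z :=
  Eval vm_compute in map sample_value (iota 0 49).

(** The new variable of an exchange is the one whose value at the sample matrix
    satisfies the exchange relation. *)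
Definition partner (z : nat) (c : column) : nat :=
  let value := nth Z0 sample_values in
  let rhs := exch_rhs Z_ops value c in
  find (fun z' => Z.eqb (Z.mul (value z) (value z')) rhs) (iota 0 42).

Definition make_seed (zs : seq nat) (b : nat -> nat -> int) : unlabelled_seed :=
  let zs := sort leq zs in
  [seq let c := [seq e <- [seq (x, b x z) | x <- zs ++ iota 42 7] | e.2 != 0%R]
       in (z, (partner z c, c)) | z <- zs].

Definition mutated_entry (b : nat -> nat -> int) (z z' x y : nat) : int :=
  let x := if x == z' then z else x in
  let y := if y == z' then z else y in
  if (x == z) || (y == z) then (- b x y)%R
  else if b z y == 0%R then b x y
  else (b x y + ((`|b x z| * b z y + b x z * `|b z y|) %/ 2)%Z)%R.

Definition mutated_ids (s : unlabelled_seed) (z : nat) : seq nat :=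
  (exchange s z).1 :: rem z (ids s).

Definition mutate_unlabelled (s : unlabelled_seed) (z : nat) : unlabelled_seed :=
  make_seed (mutated_ids s z) (mutated_entry (entry s) z (exchange s z).1).

(** Breadth-first search.  A seed is recognised by its sorted cluster. *)
Fixpoint explore (fuel : nat) (seen fresh : seq unlabelled_seed) :
    seq unlabelled_seed :=
  if fuel is n.+1 then
    let add_new acc t :=
      if ids t \in acc.2 then acc else (rcons acc.1 t, ids t :: acc.2) in
    let next := flatten [seq [seq mutate_unlabelled s z | z <- ids s] | s <- fresh] in
    let: (new, _) := foldl add_new ([::], map ids seen) next in
    if new is [::] then seen else explore n (seen ++ new) new
  else seen.

Definition initial_unlabelled : unlabelled_seed :=
  let triple x :=
    if x < 28 then nth [::] internals x else nth [::] intervals (x - 42) in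
  let cluster := [seq I_list c.1 c.2 | c <- grid] in
  make_seed (map triple_id cluster) (fun x y =>
    let c := nth (0, 0) grid (index (triple y) cluster) in
    exch0 (triple x) c.1 c.2).

(** Each entry also records, in the order of its cluster, the positions in the
    table of the adjacent seeds.  These positions are binary numbers to keep the
    table small. *)
Definition seeds : seq (unlabelled_seed * seq BinNums.N) := Eval vm_compute in
  let ss := explore 100 [:: initial_unlabelled] [:: initial_unlabelled] in
  let clusters := map ids ss in
  [seq (s, [seq BinNat.N.of_nat (index (sort leq (mutated_ids s z)) clusters)
           | z <- ids s]) | s <- ss].

(** All pairs of a replacing variable and a column that occur with a given
    variable.  The 4998 columns of the table involve only 385 exchange
    relations, up to orientation, so that each polynomial identity is checked
    once per orientation. *)
Definition relations : seq (seq (nat * column)) := Eval vm_compute in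
  [seq undup [seq e.2 | e <- flatten (unzip1 seeds) & e.1 == z] | z <- iota 0 42].

Definition seed (k : nat) : unlabelled_seed := (nth ([::], [::]) seeds k).1.
Definition neighbors (k : nat) : seq nat :=
  [seq ssrnat.nat_of_bin i | i <- (nth ([::], [::]) seeds k).2].

(** * Verification of the enumeration *)

Definition relation_ok (value : seq Zpoly) (z : nat) (e : nat * column) : bool :=
  let v := nth (one Zpoly_ops) value in
  [&& e.1 < 42, uniq (unzip1 e.2), all (fun x => x < 49) (unzip1 e.2) &
    Ring_polynom.Peq Z.eqb (mul Zpoly_ops (v z) (v e.1))
      (exch_rhs Zpoly_ops v e.2)].

(** The unknown 3 j + i is the entry (i, j) of a generic matrix.  Numbering the
    unknowns by columns shortens the computation with Horner forms. *)
Definition generic_value (d : nat) : Zpoly :=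
  cvar_formula Zpoly_ops (det3 Zpoly_ops (fun i j => Zpoly_var (3 * j + i))) d.

Lemma relations_ok :
  let value := map generic_value (iota 0 49) in
  all (fun z => all (relation_ok value z) (nth [::] relations z)) (iota 0 42).
Proof. vm_cast_no_check (erefl true). Qed.

Definition well_formed (s : unlabelled_seed) : bool :=
  uniq (rows s) && all (fun e => [&& e.1 < 42, e.2 \in nth [::] relations e.1 &
    all (fun x => x \in rows s) (unzip1 e.2.2)]) s.

(** Agreement of [t] with the matrix mutation of [s] at [z], after the renaming
    of z into z'.  A column whose entry m in the row z is zero does not change,
    and is compared as a whole. *)
Definition mutates_to (s : unlabelled_seed) (z : nat) (t : unlabelled_seed) : bool :=
  let: (z', cz) := exchange s z in
  (ids t == sort leq (z' :: rem z (ids s))) &&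
  all (fun y =>
    let c' := (exchange t y).2 in
    if y == z' then
      all (fun x => coef c' x == - coef cz (if x == z' then z else x))%R (rows t)
    else
      let c := (exchange s y).2 in
      let m := coef c z in
      if m == 0%R then (c' == c) && (coef c z' == 0%R)
      else all (fun x => coef c' x ==
        if x == z' then - m
        else coef c x + ((`|coef cz x| * m + coef cz x * `|m|) %/ 2)%Z)%R (rows t))
    (ids t).

Lemma seeds_ok : all (fun k => well_formed (seed k) &&
    all2 (fun z k' => (k' < 833) && mutates_to (seed k) z (seed k'))
      (ids (seed k)) (neighbors k)) (iota 0 833).
Proof. vm_cast_no_check (erefl true). Qed.

(** Every seed but the first is adjacent to an earlier one, so that induction on
    the position reaches all of them from the first. *)
Lemma seeds_connected : all (fun k =>
    has (fun j => (j < k) && (k \in neighbors j)) (neighbors k)) (iota 1 832).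
Proof. vm_cast_no_check (erefl true). Qed.

Lemma seeds_cover :
  all (fun d => has (fun k => d \in ids (seed k)) (iota 0 833)) (iota 0 42).
Proof. vm_cast_no_check (erefl true). Qed.

Lemma sample_uniq : uniq (map sample_value (iota 0 42)).
Proof. vm_cast_no_check (erefl true). Qed.

Lemma sample_neq0 : Z0 \notin map sample_value (iota 0 42).
Proof. vm_cast_no_check (erefl true). Qed.

Lemma seed0_ids :
  perm_eq (ids (seed 0)) [seq triple_id (I_list c.1 c.2) | c <- grid].
Proof. vm_cast_no_check (erefl true). Qed.

Lemma seed0_entry : all (fun c => all (fun s =>
    entry (seed 0) (triple_id s) (triple_id (I_list c.1 c.2)) == exch0 s c.1 c.2)
    (intervals ++ [seq I_list c.1 c.2 | c <- grid])) grid.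
Proof. vm_cast_no_check (erefl true). Qed.

Lemma grid_internal : all (fun c => I_list c.1 c.2 \in internals) grid.
Proof. vm_cast_no_check (erefl true). Qed.

Lemma seed0_skew : all (fun x => all (fun y =>
  entry (seed 0) x y == - entry (seed 0) y x)%R (ids (seed 0))) (ids (seed 0)).
Proof. vm_cast_no_check (erefl true). Qed.

(** * The cluster variables as elements of the function field *)

Section ClusterVariables.
Variable C : numFieldType.
Local Notation F := (func_field C 3 7).

Definition cvar_coord (d : nat) : coord_ring C 3 7 :=
  cvar_formula (ring_ops _) (fun s => plucker C 3 (column_set s)) d.
Definition cvar (d : nat) : F := tofrac (cvar_coord d).

Lemma ev_cvar_coord A d : d < 49 ->
  ev A (cvar_coord d) = cvar_formula (ring_ops C) (det3 (ring_ops C) (entries A)) d.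
Proof.
move=> d49; apply: cvar_formula_morph => //; first exact: rmorph_ops.
exact: ev_column_set.
Qed.

(** At every matrix the relation is the evaluation of an identity between
    polynomials in the entries, which [relation_ok] has normalised. *)
Lemma cvar_coord_relation z e (value := map generic_value (iota 0 49)) :
    z < 49 -> relation_ok value z e ->
  (cvar_coord z * cvar_coord e.1 = exch_rhs (ring_ops _) cvar_coord e.2)%R.
Proof.
move=> z49 /and4P[e42 _ /allP c49 rel]; apply: ev_inj => A.
rewrite rmorphM /= !ev_cvar_coord ?(leq_trans e42) //.
pose l := [seq entries A (k %% 3) (k %/ 3) | k <- iota 0 21].
have evalE d : d < 49 -> Zpoly_eval l (nth (one Zpoly_ops) value d) =
    cvar_formula (ring_ops C) (det3 (ring_ops C) (entries A)) d.
  move=> d49; rewrite (nth_map 0) ?size_iota // nth_iota // add0n.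
  apply: cvar_formula_morph => // [|s sT]; first exact: Zpoly_eval_ops.
  rewrite (det3_morph _ _ (Zpoly_eval_ops l)); apply: det3_eq => // i j i3 j7.
  rewrite Zpoly_eval_var; have k21 : 3 * j + i < 21.
    by rewrite -[21]/(3 * 6 + 3) -addnS leq_add // leq_mul2l.
  rewrite (nth_map 0) ?size_iota // nth_iota // add0n.
  by rewrite mulnC divnMDl // divn_small // addn0 modnMDl modn_small.
have := Zpoly_eval_eq l rel; have [_ _ _ ->] := Zpoly_eval_ops l.
rewrite !evalE ?(leq_trans e42) // => /= ->.
rewrite (exch_rhs_morph (Zpoly_eval_ops l) (v' := fun d => ev A (cvar_coord d))).
  by rewrite (exch_rhs_morph (rmorph_ops (ev A)) (v' := fun d => ev A (cvar_coord d))).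
by move=> x /c49 x49; rewrite evalE // ev_cvar_coord.
Qed.

Lemma cvar_relation z e : z < 42 -> e \in nth [::] relations z ->
  (cvar z * cvar e.1 = exch_rhs (ring_ops _) cvar e.2)%R.
Proof.
move=> z42 ez; rewrite /cvar -rmorphM (@cvar_coord_relation z) ?(leq_trans z42) //.
  exact: exch_rhs_morph (rmorph_ops _) _.
have /allP/(_ z) := relations_ok; rewrite mem_iota => /(_ z42)/allP; exact.
Qed.

(** The values in Z of the sample matrix, transported to [C] by the unique ring
    morphism, which is injective in characteristic zero. *)
Lemma cvar_sample :
  exists2 g : Z -> C, injective g /\ g Z0 = 0%R &
  forall d, d < 42 ->
    ev (\matrix_(i, j) g (sample i j)) (cvar_coord d) = g (sample_value d).
Proof.
exists (ofZ C).
  by split=> // x y /intr_inj/(can_inj int_of_ZK).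
move=> d d42; rewrite ev_cvar_coord ?(leq_trans d42) //.
symmetry.
apply: (cvar_formula_morph (leq_trans d42 _) (ofZ_ops C)) => // s sT.
rewrite (det3_morph _ _ (ofZ_ops C)); apply: det3_eq => // i j i3 j7.
by rewrite /entries mxE !inordK.
Qed.

Lemma cvar_inj : {in gtn 42 &, injective cvar}.
Proof.
have [g [g_inj _] gE] := cvar_sample.
move=> d e /=; rewrite !inE => d42 e42 /eqP; rewrite tofrac_eq => /eqP de.
have := gE d d42; rewrite de gE // => /g_inj/esym.
have /(uniqP Z0) := sample_uniq => sample_inj sde.
apply: sample_inj; rewrite ?inE ?size_map ?size_iota //.
rewrite !(nth_map 0) ?size_iota // !nth_iota // !add0n.
Qed.

Lemma cvar_neq0 z : z < 42 -> cvar z != 0%R.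
Proof.
move=> z42; rewrite /cvar tofrac_eq0; apply/eqP => z0.
have [g [g_inj g0] gE] := cvar_sample.
have := gE z z42; rewrite z0 rmorph0 -g0 => /g_inj e.
by case/negP: sample_neq0; rewrite [X in X \in _]e map_f // mem_iota.
Qed.
End ClusterVariables.

(** * Labelled seeds *)

Lemma mem_exchange (s : unlabelled_seed) z : z \in ids s -> (z, exchange s z) \in s.
Proof.
elim: s => [//|[y e] s IH] /=; rewrite !inE eqnE [y == z]eq_sym.
by case: eqP => [-> _|_ /= /IH ->]; rewrite ?eqxx ?orbT.
Qed.

(** Translates the products over the entries of a sparse column into products
    over all rows, where the absent entries are zero. *)
Lemma monomial_prod (R : comNzRingType) (v : nat -> R) (P : int -> bool)
    (c : column) (rs : seq nat) :
    P 0%R = false -> uniq (unzip1 c) -> uniq rs -> {subset unzip1 c <= rs} ->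
  foldr (fun e t => if P e.2 then iter `|e.2| (mul (ring_ops R) (v e.1)) t else t)
    1%R c = (\prod_(x <- rs | P (coef c x)) v x ^+ `|coef c x|)%R.
Proof.
move=> P0; elim: c rs => [|[y a] c IH] rs /=; first by rewrite P0 big_pred0.
move=> /andP[yNc c_uniq] rs_uniq c_rs.
have y_rs : y \in rs by apply: c_rs; rewrite mem_head.
rewrite (perm_big _ (perm_to_rem y_rs)) big_cons eqnE eqxx.
have -> : (\prod_(x <- rem y rs | P (if eqn y x then a else coef c x))
     v x ^+ `|if eqn y x then a else coef c x|)%R =
   (\prod_(x <- rem y rs | P (coef c x)) v x ^+ `|coef c x|)%R.
  rewrite big_seq_cond [RHS]big_seq_cond.
  have yx x : x \in rem y rs -> eqn y x = false.
    by rewrite mem_rem_uniq // !inE eqnE eq_sym => /andP[/negbTE].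
  by apply: eq_big => [x|x /andP[/yx -> //]]; case: (boolP (x \in _)) => // /yx ->.
rewrite -IH ?rem_uniq //; last first.
  move=> x xc; rewrite mem_rem_uniq // inE c_rs ?inE ?xc ?orbT // andbT.
  by apply: contraNneq yNc => <-.
case: ifP => //= _; elim: `|a| => [|m IHm] /=; first by rewrite expr0 mul1r.
by rewrite IHm exprS mulrA.
Qed.

Section Labellings.
Variables (C : numFieldType) (I : finType).
Local Notation F := (func_field C 3 7).
Local Notation preseed := (preseed F I 'I_7).

Definition row_id (l : I -> nat) (r : I + 'I_7) : nat :=
  match r with inl i => l i | inr a => 42 + a end.

(** [S] is the unlabelled seed [s], the label i standing for the number l i.
    Mutation changes the bijection [l] in an essential way: going around a
    pentagon exchanges two labels.  This is why a table of 833 entries is enough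
    although there are many more labelled seeds. *)
Definition labelling (l : I -> nat) (S : preseed) (s : unlabelled_seed) : Prop :=
  [/\ perm_eq [seq l i | i <- enum I] (ids s),
      ext_cluster S =1 cvar C \o row_id l
    & forall r i, exch S r i = entry s (row_id l r) (l i)].

Lemma row_id_rows l s : perm_eq [seq l i | i <- enum I] (ids s) ->
  perm_eq [seq row_id l r | r <- enum {: I + 'I_7}] (rows s).
Proof.
move=> l_ids; rewrite enumT unlock /= /sum_enum map_cat -!map_comp.
rewrite -!enumT; apply: perm_cat; first by rewrite (eq_map (g := l)).
have -> : iota 42 7 = [seq 42 + a | a <- map val (enum 'I_7)].
  by rewrite val_enum_ord.
by rewrite -map_comp.
Qed.

Lemma row_id_inj l s : perm_eq [seq l i | i <- enum I] (ids s) ->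
  uniq (rows s) -> injective (row_id l).
Proof.
move=> /row_id_rows/perm_uniq e s_uniq; apply/injectiveP.
by rewrite /injectiveb /dinjectiveb e.
Qed.

(** The exchange relation of the table has the two products of the mutation rule
    as its right-hand side; division by the old variable is legitimate as it is
    nonzero. *)
Lemma mutate_cluster l S s i : labelling l S s -> well_formed s ->
  cluster (mutate S i) i = cvar C (exchange s (l i)).1.
Proof.
move=> lSs /andP[s_uniq /allP s_ok]; have [l_ids lv lb] := lSs.
have li_s : l i \in ids s by rewrite -(perm_mem l_ids) map_f ?mem_enum.
have /and3P[e42 e_rel /allP e_rows] := s_ok _ (mem_exchange li_s).
have li42 : l i < 42 by [].
have e_uniq : uniq (unzip1 (exchange s (l i)).2).
  have /allP/(_ (l i)) := relations_ok; rewrite mem_iota => /(_ li42)/allP.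
  by move=> /(_ _ e_rel)/and4P[].
have li0 : cluster S i != 0%R.
  by rewrite -[cluster S i]/(ext_cluster S (inl i)) lv cvar_neq0.
rewrite /= eqxx; apply: (canLR (mulfK li0)).
rewrite -[cluster S i]/(ext_cluster S (inl i)) lv /=.
rewrite mulrC (cvar_relation _ li42 e_rel) /exch_rhs /=.
have prodE P : P 0%R = false ->
    (\prod_(r | P (exch S r i)) ext_cluster S r ^+ `|exch S r i|)%R =
    foldr (fun e t => if P e.2 then iter `|e.2| (mul (ring_ops F) (cvar C e.1)) t
      else t) 1%R (exchange s (l i)).2.
  move=> P0; rewrite (monomial_prod _ P0 e_uniq s_uniq e_rows).
  rewrite -(perm_big _ (row_id_rows l_ids)) big_map big_enum_cond /=.
  by apply: eq_big => r; rewrite ?lb // => _; rewrite lv.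
by rewrite (prodE (fun a => 0 < a)%R) // (prodE (fun a => a < 0)%R).
Qed.

(** Mutation keeps the label and changes the number from z to z'.  Since no
    number is repeated in [s] or [t], the tests on numbers in [mutates_to] agree
    with the tests on labels in the mutation rule. *)
Lemma labelling_mutate l S s t i : labelling l S s ->
    well_formed s -> well_formed t -> mutates_to s (l i) t ->
  labelling (fun j => if j == i then (exchange s (l i)).1 else l j)
    (mutate S i) t.
Proof.
move=> lSs s_wf t_wf s_t; set l' := (X in labelling X).
have [l_ids lv lb] := lSs; move: s_t.
have [s_uniq _] := andP s_wf; have [t_uniq _] := andP t_wf.
rewrite /mutates_to; set z := l i.
case e_z : (exchange s z) => [z' cz] /andP[/eqP t_sorted /allP t_ok].
have t_ids : perm_eq (ids t) (z' :: rem z (ids s)).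
  by rewrite t_sorted; apply/permPl/perm_sort.
have l'i : l' i = z' by rewrite /l' eqxx -/z e_z.
have l'N j : j != i -> l' j = l j by rewrite /l' /= => /negbTE->.
have l'_ids : perm_eq [seq l' j | j <- enum I] (ids t).
  apply: perm_trans (_ : perm_eq _ (z' :: rem z (ids s))) _; last by rewrite perm_sym.
  have i_enum : i \in enum I by rewrite mem_enum.
  have := perm_to_rem i_enum => I_i.
  apply: perm_trans (perm_map l' I_i) _; rewrite /= l'i perm_cons.
  have -> : [seq l' j | j <- rem i (enum I)] = [seq l j | j <- rem i (enum I)].
    apply/eq_in_map => j; rewrite mem_rem_uniq ?enum_uniq // !inE.
    by move=> /andP[ji _]; apply: l'N.
  rewrite -(perm_cons z); apply: perm_trans (_ : perm_eq _ (ids s)) _.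
    by rewrite perm_sym; apply: perm_trans (perm_map l I_i); rewrite perm_sym.
  by apply: perm_to_rem; rewrite -(perm_mem l_ids) map_f.

have l'_inj := row_id_inj l'_ids t_uniq.
have row_i : row_id l' (inl i) = z' by rewrite -l'i.
have rowN r : r != inl i -> row_id l' r = row_id l r.
  by case: r => [j ji|//]; apply: l'N; apply: contraNneq ji => ->.
split=> //.
  case=> [j|a]; last exact: (lv (inr a)).
  have [->|ji] := eqVneq j i; last first.
    by rewrite /= (negbTE ji) l'N //; apply: (lv (inl j)).
  by rewrite [LHS](mutate_cluster i lSs s_wf) /= l'i -/z e_z.
move=> r j.
have r_t : row_id l' r \in rows t.
  by rewrite -(perm_mem (row_id_rows l'_ids)) map_f ?mem_enum.
have j_t : l' j \in ids t by rewrite -(perm_mem l'_ids) map_f ?mem_enum.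
have r_i : (row_id l' r == z') = (r == inl i) by rewrite -row_i inj_eq.
have j_i : (l' j == z') = (j == i).
  by rewrite -row_i -[l' j]/(row_id l' (inl j)) inj_eq.
have := t_ok _ j_t; rewrite j_i; have [{j j_i j_t}->|ji] := eqVneq j i.
  move=> /allP/(_ _ r_t)/eqP; rewrite -/(entry _ _ _) l'i => ->.
  rewrite r_i /= eqxx orbT lb -/z /entry e_z; congr (- coef _ _)%R.
  by have [->|/rowN->] := eqVneq.
rewrite /= (negbTE ji) orbF !lb l'N // -/z.
case: eqP => [m0 /andP[/eqP tj /eqP sj0]|_ /allP/(_ _ r_t)/eqP].
  have m0' : entry s (row_id l (inl i)) (l j) = 0%R := m0.
  rewrite [entry t _ _]/entry tj; have [->|ri] := eqVneq r (inl i).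
    by rewrite row_i sj0 m0' oppr0.
  by rewrite m0' normr0 !mulr0 add0r div0z addr0 rowN.
rewrite -/(entry t _ _) r_i => ->; have [->|ri] := eqVneq r (inl i); first by [].
by rewrite -/(entry s _ _) rowN // /entry e_z.
Qed.
End Labellings.

Lemma all2_memP (S T : eqType) (r : S -> T -> bool) s t : all2 r s t ->
  (forall x, x \in s -> exists2 y, y \in t & r x y) /\
  (forall y, y \in t -> exists2 x, x \in s & r x y).
Proof.
elim: s t => [|x s IH] [|y t] //= /andP[rxy /IH[sP tP]]; split=> u.
  rewrite inE => /predU1P[->|/sP[v vt ruv]]; first by exists y; rewrite ?mem_head.
  by exists v; rewrite // inE vt orbT.
rewrite inE => /predU1P[->|/tP[v vt ruv]]; first by exists x; rewrite ?mem_head.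
by exists v; rewrite // inE vt orbT.
Qed.

Lemma seed_wf k : k < 833 -> well_formed (seed k).
Proof.
move=> k833; have /allP/(_ k) := seeds_ok.
by rewrite mem_iota => /(_ k833)/andP[].
Qed.

Lemma seed_neighbors k : k < 833 ->
  (forall z, z \in ids (seed k) ->
     exists k', k' < 833 /\ mutates_to (seed k) z (seed k')) /\
  (forall k', k' \in neighbors k ->
     exists2 z, z \in ids (seed k) & mutates_to (seed k) z (seed k')).
Proof.
move=> k833; have /allP/(_ k) := seeds_ok; rewrite mem_iota => /(_ k833)/andP[_].
move=> /all2_memP[h1 h2]; split=> [z /h1[k' _ /andP[]]|k' /h2[z zk /andP[]]].
  by exists k'.
by exists z.
Qed.

(** * All seeds in a mutation class *)

Section Orbit.
Variables (C : numFieldType) (I : finType).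
Local Notation preseed := (preseed (func_field C 3 7) I 'I_7).
Variables (S0 : preseed) (l0 : I -> nat).
Hypothesis lS0 : labelling l0 S0 (seed 0).

Lemma mutation_labelled zs : exists k l,
  k < 833 /\ labelling l (foldl (@mutate _ _ _) S0 zs) (seed k).
Proof.
elim/last_ind: zs => [|zs i [k [l [k833 lS]]]]; first by exists 0, l0.
rewrite foldl_rcons; have [l_ids _ _] := lS; have [h _] := seed_neighbors k833.
have /h[k' [k'833 kk']] : l i \in ids (seed k).
  by rewrite -(perm_mem l_ids) map_f ?mem_enum.
eexists k', _; split=> //.
by apply: labelling_mutate lS _ _ kk'; apply: seed_wf.
Qed.

Lemma seed_reached k : k < 833 -> exists zs l,
  labelling l (foldl (@mutate _ _ _) S0 zs) (seed k).
Proof.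
elim/ltn_ind: k => -[|k] IH k833; first by exists [::], l0.
have /allP/(_ k.+1) := seeds_connected; rewrite mem_iota => /(_ k833).
case/hasP=> j _ /andP[jk kj]; have j833 := ltn_trans jk k833.
have [zs [l lS]] := IH j jk j833; have [_ h] := seed_neighbors j833.
have [z zj jzk] := h _ kj; have [l_ids _ _] := lS.
move: zj; rewrite -(perm_mem l_ids) => /mapP[i _ z_i].
exists (rcons zs i); eexists; rewrite foldl_rcons.
by apply: labelling_mutate lS _ _ _; rewrite -?z_i //; apply: seed_wf.
Qed.

Lemma cluster_cvar zs i : exists2 d, d < 42 &
  cluster (foldl (@mutate _ _ _) S0 zs) i = cvar C d.
Proof.
have [k [l [k833 [l_ids lv _]]]] := mutation_labelled zs.
exists (l i); last exact: (lv (inl i)).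
have /mem_exchange li : l i \in ids (seed k).
  by rewrite -(perm_mem l_ids) map_f ?mem_enum.
by have /andP[_ /allP/(_ _ li)/andP[]] := seed_wf k833.
Qed.

Lemma cvar_cluster d : d < 42 -> exists zs i,
  cluster (foldl (@mutate _ _ _) S0 zs) i = cvar C d.
Proof.
move=> d42; have /allP/(_ d) := seeds_cover.
rewrite mem_iota => /(_ d42)/hasP[k]; rewrite mem_iota => /andP[_ k833] dk.
have [zs [l [l_ids lv _]]] := seed_reached k833.
move: dk; rewrite -(perm_mem l_ids) => /mapP[i _ ->].
by exists zs, i; apply: (lv (inl i)).
Qed.
End Orbit.

(** * The initial seed *)

Lemma exists_iota m (P : nat -> bool) : [exists a : 'I_m, P a] = has P (iota 0 m).
Proof.
apply/existsP/hasP => [[a Pa]|[a]].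
  by exists (val a); rewrite // mem_iota ltn_ord.
by rewrite mem_iota => am Pa; exists (Ordinal am).
Qed.

(** Membership in [I_set] without ordinals, so that it is decided by
    computation for all relevant arguments. *)
Definition mem_I_set (i j x : nat) : bool :=
  let p : int := (7%:Z - 3%:Z - ((i%:Z + j%:Z - 2) %/ 2)%Z)%R in
  let p' : int := (7%:Z - 3%:Z + 2 + ((i%:Z + j%:Z - 1) %/ 2)%Z)%R in
  has (fun a => (x.+1%:Z == p + a%:Z %[mod 7%:Z])%Z) (iota 0 i)
  || has (fun b => (x.+1%:Z == p' + b%:Z %[mod 7%:Z])%Z) (iota 0 (3 - i)).

Lemma mem_I_list : all (fun i => all (fun j => all (fun x =>
  mem_I_set i j x == (x \in I_list i j)) (iota 0 7)) (iota 0 5)) (iota 0 4).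
Proof. vm_cast_no_check (erefl true). Qed.

Lemma I_set_list i j : i < 4 -> j < 5 -> I_set 3 7 i j = column_set (I_list i j).
Proof.
move=> i4 j5; apply/setP => x; rewrite !finset.in_set.
have /allP/(_ i) := mem_I_list; rewrite mem_iota => /(_ i4)/allP/(_ j).
rewrite mem_iota => /(_ j5)/allP/(_ x).
rewrite mem_iota => /(_ (ltn_ord x))/eqP <-.
by rewrite /mem_I_set -!exists_iota.
Qed.

Lemma cyclic_interval_list a : cyclic_interval 3 a = column_set (nth [::] intervals a).
Proof.
apply/setP => x; rewrite !finset.in_set.
rewrite (exists_iota 3 (fun b => x == a + b %[mod 7])).
have : all (fun a => all (fun x =>
    has (fun b => x == a + b %[mod 7]) (iota 0 3)
    == (x \in nth [::] intervals a)) (iota 0 7)) (iota 0 7) by vm_compute.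
move/allP/(_ a); rewrite mem_iota => /(_ (ltn_ord a))/allP/(_ x).
by rewrite mem_iota => /(_ (ltn_ord x))/eqP.
Qed.

Lemma I_list_triple i j : i < 4 -> j < 5 -> I_list i j \in triples.
Proof.
have : all (fun i => all (fun j => I_list i j \in triples) (iota 0 5)) (iota 0 4).
  by vm_compute.
move=> /allP/(_ i); rewrite mem_iota => h i4.
by have /allP/(_ j) := h i4; rewrite mem_iota; apply.
Qed.

Section Initial.
Variable C : numFieldType.
Local Notation idx := (mut_index 3 7).

Definition row_triple (r : idx + 'I_7) : seq nat :=
  match r with inl c => I_list c.1.+1 c.2.+1 | inr a => nth [::] intervals a end.

Definition initial_label (c : idx) : nat := triple_id (row_triple (inl c)).

Lemma mem_grid (c : idx) : (c.1.+1, c.2.+1) \in grid.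
Proof.
by case: c => i j; apply: allpairs_f; rewrite mem_iota /= ltnS; apply: ltn_ord.
Qed.

Lemma row_setE r : row_set r = column_set (row_triple r).
Proof.
case: r => [[i j]|a] /=; last exact: cyclic_interval_list.
have i2 : i < 2 := ltn_ord i; have j3 : j < 3 := ltn_ord j.
by apply: I_set_list; [exact: ltnW | exact: ltnW].
Qed.

Lemma row_triple_list r :
  row_triple r \in intervals ++ [seq I_list c.1 c.2 | c <- grid].
Proof.
rewrite mem_cat; case: r => [c|a] /=; last by rewrite mem_nth.
by apply/orP; right; apply: (map_f (fun c => I_list c.1 c.2)) (mem_grid c).
Qed.

Lemma initial_internal (c : idx) : I_list c.1.+1 c.2.+1 \in internals.
Proof. by have /allP/(_ _ (mem_grid c)) := grid_internal. Qed.

Lemma row_triple_triples r : row_triple r \in triples.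
Proof.
case: r => [c|a] /=; last exact: intervals_triple.
by have := initial_internal c; rewrite mem_filter => /andP[].
Qed.

Lemma triple_id_row r : row_id initial_label r = triple_id (row_triple r).
Proof.
case: r => [//|a] /=.
have : all (fun a => 42 + a == triple_id (nth [::] intervals a)) (iota 0 7).
  by vm_compute.
by move/allP/(_ a); rewrite mem_iota => /(_ (ltn_ord a))/eqP.
Qed.

Lemma cvar_coord_row r :
  cvar_coord C (row_id initial_label r) = plucker C 3 (row_set r).
Proof.
rewrite row_setE; case: r => [c|a]; last first.
  by rewrite /cvar_coord /cvar_formula /= ?addKn.
rewrite /= /initial_label /triple_id initial_internal /cvar_coord /cvar_formula.
have -> : index (row_triple (inl c)) internals < 28.
  by rewrite -[28]/(size internals) index_mem initial_internal.
by rewrite nth_index ?initial_internal.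
Qed.

Lemma initial_exchE r c : initial_exch r c =
  entry (seed 0) (row_id initial_label r) (initial_label c).
Proof.
have /allP/(_ _ (mem_grid c))/allP/(_ _ (row_triple_list r))/eqP := seed0_entry.
rewrite triple_id_row /initial_label /row_triple /= => ->.
have c1 : c.1 < 2 := ltn_ord c.1; have c2 : c.2 < 3 := ltn_ord c.2.
rewrite /initial_exch /exch0 row_setE !inE /=.
have eqE i j : i < 4 -> j < 5 ->
    (column_set (row_triple r) == I_set 3 7 i j) = (row_triple r == I_list i j).
  move=> i4 j5; rewrite I_set_list //; apply/eqP/eqP => [|-> //].
  by apply: column_set_inj; rewrite ?row_triple_triples ?I_list_triple.
have c14 : c.1 < 4 := leq_trans c1 (isT : 2 <= 4).
have c14' : c.1.+1 < 4 := leq_ltn_trans c1 (isT : 2 < 4).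
have c25 : c.2 < 5 := leq_trans c2 (isT : 3 <= 5).
have c25' : c.2.+1 < 5 := leq_ltn_trans c2 (isT : 3 < 5).
by rewrite !eqE.
Qed.

Lemma initial_labelling : labelling initial_label (initial_seed C 3 7) (seed 0).
Proof.
split=> [|r|r c]; last exact: initial_exchE.
- apply: perm_trans (_ : perm_eq _ _) _; last by rewrite perm_sym; exact: seed0_ids.
  rewrite enumT unlock /= /prod_enum !enum_ordSl !enum_ord0; exact: perm_refl.
by rewrite /= /cvar cvar_coord_row; case: r.
Qed.
End Initial.

Local Open Scope ring_scope.

(** * Independence of the initial family *)

Section Independence.
Variable C : numFieldType.

(** Up to the action of GL_3, the columns 2, 3, 6 may be taken to be multiples of
    the basis vectors, the value d of the minor 236 being put into the column 2.
    The remaining twelve minors, read in a suitable order, each determine one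
    new entry by an equation of degree one in this entry.  Its leading
    coefficient is, up to sign, 1 or a prescribed minor, possibly divided
    by d. *)
Lemma exists_matrix_with_minors (g : seq nat -> C) : (forall s, g s != 0) ->
  exists A : 'M[C]_(3, 7), forall r,
    det3 (ring_ops C) (entries A) (row_triple r) = g (row_triple r).
Proof.
move=> g0; pose G a b c := g [:: a; b; c].
have G0 a b c : G a b c != 0 by apply: g0.
(* (xj, yj, zj) is the column j. *)
pose d := G 2 3 6.
pose x0 := G 0 3 6.
pose y0 := - G 0 2 6 / d.
pose z0 := G 0 2 3 / d.
pose x5 := - G 3 5 6.
pose x4 := - G 3 4 6.
pose z4 := G 2 3 4 / d.
pose y5 := (G 0 5 6 + y0 * x5) / x0.
pose y4 := (x4 * y5 - G 4 5 6) / x5.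
pose z5 := (z4 * x5 - G 3 4 5) / x4.
pose z1 := G 1 2 3 / d.
pose y1 := (y0 * z1 - G 0 1 2 / d) / z0.
pose x1 := (x0 * y1 - G 0 1 6) / y0.
pose cols := [:: [:: x0; y0; z0]; [:: x1; y1; z1]; [:: d; 0; 0]; [:: 0; 1; 0];
  [:: x4; y4; z4]; [:: x5; y5; z5]; [:: 0; 0; 1]].
exists (\matrix_(i, j) nth 0 (nth [::] cols j) i) => r.
have /triplesP[a [b [c [e _ _ _]]]] := row_triple_triples r.
have AE s : s \in triples -> det3 (ring_ops C)
    (entries (\matrix_(i, j) nth 0 (nth [::] cols j) i)) s =
    det3 (ring_ops C) (fun i j => nth 0 (nth [::] cols j) i) s.
  by move=> sT; apply: det3_eq => // i j i3 j7; rewrite /entries mxE !inordK.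
rewrite AE ?row_triple_triples // {AE a b c e}.
have := row_triple_list r; rewrite [X in _ \in X -> _](_ : _ =
  [:: [:: 0; 1; 2]; [:: 1; 2; 3]; [:: 2; 3; 4]; [:: 3; 4; 5]; [:: 4; 5; 6];
      [:: 0; 5; 6]; [:: 0; 1; 6]; [:: 3; 5; 6]; [:: 0; 3; 6]; [:: 0; 2; 6];
      [:: 3; 4; 6]; [:: 2; 3; 6]; [:: 0; 2; 3]]%N); last by [].
rewrite !inE; do 12?case/orP; move=> /eqP->; rewrite /det3 /= -/(G _ _ _).
all: rewrite /x1 /y1 /z1 /z5 /y4 /y5 /z4 /x4 /x5 /z0 /y0 /x0 /d.
all: by field; rewrite ?G0.
Qed.
End Independence.

(** * The initial data form a seed *)

Section IsSeed.
Variable C : numFieldType.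
Local Notation F := (func_field C 3 7).
Local Notation S0 := (initial_seed C 3 7).
Local Notation iota_C := (@coord_const C 3 7).
Local Notation rational := (rational_in iota_C (ext_cluster S0)).

Lemma mmap_tofrac m (g : 'I_m -> coord_ring C 3 7) (p : {mpoly C[m]}) :
  mmap iota_C (fun i => tofrac (g i)) p =
  tofrac (\sum_(u <- msupp p) coord_class (p@_u)%:MP * mmap1 g u).
Proof.
rewrite rmorph_sum; apply: eq_bigr => u _; rewrite rmorphM; congr (_ * _).
by rewrite rmorph_prod; apply: eq_bigr => i _; rewrite rmorphXn /=.
Qed.

(** A relation between the thirteen functions holds for their values at all
    matrices, hence at all points with nonzero coordinates. *)
Lemma initial_independent : algebraically_independent iota_C (ext_cluster S0).
Proof.
move=> p; rewrite (_ : _ \o _ =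
    fun i => tofrac (plucker C 3 (row_set (enum_val i)))); last first.
  by apply: funext => i /=; case: (enum_val i).
rewrite mmap_tofrac => /eqP; rewrite tofrac_eq0 => /eqP p0.
apply: mpoly_eq0_nonzero_points => c c0.
pose T := (mut_index 3 7 + 'I_7)%type.
pose g s :=
  oapp (fun r : T => c (enum_rank r)) 1 [pick r : T | row_triple r == s].
have gE (r : T) : g (row_triple r) = c (enum_rank r).
  rewrite /g; case: pickP => [r' /eqP e|/(_ r)]; last by rewrite eqxx.
  congr (c (enum_rank _)).
  have [/(row_id_inj (s := seed 0)) inj _ _] := initial_labelling C.
  apply: inj; last by rewrite !triple_id_row e.
  by have /andP[] := seed_wf (isT : 0 < 833)%N.
have [|A AE] := @exists_matrix_with_minors C g.
  by move=> s; rewrite /g; case: pickP => [r _|_] /=; rewrite ?c0 ?oner_neq0.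
have := congr1 (ev A) p0; rewrite rmorph0 rmorph_sum => <-.
rewrite mevalE; apply: eq_bigr => u _; rewrite rmorphM /= ev_class mevalC.
rewrite rmorph_prod; congr (_ * _); apply: eq_bigr => i _; rewrite rmorphXn /=.
by rewrite row_setE ev_column_set ?row_triple_triples // AE gE enum_valK.
Qed.

(** Mutation consists of field operations.  Sequences of mutations are used here
    instead of the mutation class because the latter presupposes that the
    initial data form a seed. *)
Lemma rational_mutations zs r :
  rational (ext_cluster (foldl (@mutate _ _ _) S0 zs) r).
Proof.
elim/last_ind: zs r => [|zs z IH] r; first exact: rational_gen.
rewrite foldl_rcons; case: r => [i|a]; last exact: (IH (inr a)).
rewrite /=; case: eqP => _; last exact: (IH (inl i)).
apply: rationalM; last by apply: rationalV; apply: (IH (inl z)).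
by apply: rationalD; apply: rational_prod => r _; apply: rationalX.
Qed.

Lemma plucker_cvar s : s \in triples ->
  exists2 d, (d < 49)%N & plucker C 3 (column_set s) = cvar_coord C d.
Proof.
move=> sT; have [sI|sN] := boolP (s \in intervals).
  have sa : (index s intervals < 7)%N by rewrite -[7%N]/(size intervals) index_mem.
  exists (42 + index s intervals)%N; first by rewrite -[49%N]/(42 + 7)%N ltn_add2l.
  by rewrite /cvar_coord /cvar_formula /= addKn nth_index.
have sI : s \in internals by rewrite mem_filter sN.
have sd : (index s internals < 28)%N by rewrite -[28%N]/(size internals) index_mem.
exists (index s internals); first exact: leq_trans sd _.
by rewrite /cvar_coord /cvar_formula sd nth_index.
Qed.

Lemma rational_cvar d : (d < 49)%N -> rational (cvar C d).
Proof.
move=> d49; have [d42|d42] := ltnP d 42.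
  have [zs [i <-]] := cvar_cluster (initial_labelling C) d42.
  exact: (rational_mutations zs (inl i)).
have a7 : (d - 42 < 7)%N by rewrite ltn_subLR.
have [_ /(_ (inr (Ordinal a7))) e _] := initial_labelling C.
by rewrite -(subnKC d42) -[cvar C _]e; apply: rational_gen.
Qed.

(** Constants and Pluecker coordinates generate the field, and each Pluecker
    coordinate occurs in a seed obtained by mutations. *)
Lemma rational_all f : rational f.
Proof.
have rational_tofrac x : rational (tofrac x).
  rewrite -[x]reprK; set p := repr x.
  have -> : \pi_(coord_ring C 3 7)%qT p = \sum_(u <- msupp p)
      coord_class (p@_u)%:MP * mmap1 (fun i => @coord_class C 3 7 'X_i) u.
    rewrite -[LHS]/(coord_class p) {1}[p]mpolyE rmorph_sum.
    apply: eq_bigr => u _.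
    rewrite -mul_mpolyC rmorphM mpolyXE_id rmorph_prod; congr (_ * _).
    by apply: eq_bigr => i _; rewrite rmorphXn /=.
  rewrite -mmap_tofrac; apply: rational_mmap => i.
  have -> : coord_class 'X_i = plucker C 3 (val (enum_val i)).
    by rewrite /plucker valK enum_valK.
  have [s sT ->] := column_set_surj (eqP (valP (enum_val i))).
  by have [d d49 ->] := plucker_cvar sT; apply: rational_cvar.
have [a [b ->]] := tofrac_fraction f.
by apply: rationalM; [|apply: rationalV]; apply: rational_tofrac.
Qed.

Lemma initial_is_seed : is_seed iota_C S0.
Proof.
split; first split; first exact: initial_independent.
  by move=> y; apply: rational_dependent; apply: rational_all.
exists (fun=> 1%N); split=> // x y; rewrite !mul1r.
have [l_ids _ lb] := initial_labelling C; rewrite !lb.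
have l_mem i : initial_label i \in ids (seed 0).
  by rewrite -(perm_mem l_ids) map_f ?mem_enum.
by have /allP/(_ _ (l_mem x))/allP/(_ _ (l_mem y))/eqP := seed0_skew.
Qed.
End IsSeed.

Local Open Scope classical_set_scope.
Local Open Scope card_scope.

(** * The two families of cluster variables *)

Section Families.
Variable C : numFieldType.
Local Notation F := (func_field C 3 7).

Lemma mutation_classE (S0 : preseed F (mut_index 3 7) 'I_7) S :
  is_seed (@coord_const C 3 7) S0 ->
  mutation_class (@coord_const C 3 7) S0 S <->
  exists zs, S = foldl (@mutate _ _ _) S0 zs.
Proof.
move=> S0_seed; split=> [|[zs ->]].
  elim=> [_|{}S z _ [zs ->]]; first by exists [::].
  by exists (rcons zs z); rewrite foldl_rcons.
elim/last_ind: zs => [|zs z IH]; first exact: mutation_class_init.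
by rewrite foldl_rcons; apply: mutation_class_step.
Qed.

Lemma cluster_variables_cvar :
  grassmannian_cluster_variables C 3 7 = cvar C @` `I_42.
Proof.
apply/seteqP; split=> f.
  move=> [S /(mutation_classE _ (initial_is_seed C))[zs ->] [i ->]].
  by have [d d42 ->] := cluster_cvar (initial_labelling C) zs i; exists d.
move=> [d /= /(cvar_cluster (initial_labelling C))[zs [i <-]] <-].
exists (foldl (@mutate _ _ _) (initial_seed C 3 7) zs); last by exists i.
by apply/(mutation_classE _ (initial_is_seed C)); exists zs.
Qed.

Lemma internal_column_set s :
  s \in triples -> internal 3 (column_set s) = (s \notin intervals).
Proof.
move=> sT; rewrite /internal card_column_set //=; congr (~~ _).
apply/existsP/idP => [[a]|sI].
  rewrite cyclic_interval_list => /eqP/column_set_inj -> //; first by rewrite mem_nth.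
  exact: intervals_triple.
have s7 : (index s intervals < 7)%N by rewrite -[7%N]/(size intervals) index_mem.
by exists (Ordinal s7); rewrite cyclic_interval_list nth_index.
Qed.

Lemma cvar_internal d : (d < 28)%N ->
  cvar C d = tofrac (plucker C 3 (column_set (nth [::] internals d))).
Proof. by move=> d28; rewrite /cvar /cvar_coord /cvar_formula d28. Qed.

Lemma internal_pluckers_cvar :
  [set tofrac (plucker C 3 K) | K in [set K : {set 'I_7} | internal 3 K]]
  = cvar C @` `I_28.
Proof.
apply/seteqP; split=> f /=.
  move=> [K K_int <-]; have /andP[/eqP K3 _] := K_int.
  have [s sT Ks] := column_set_surj K3.
  move: K_int; rewrite /= Ks internal_column_set // => sN.
  have sI : s \in internals by rewrite mem_filter sN.
  have sd : (index s internals < 28)%N.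
    by rewrite -[28%N]/(size internals) index_mem.
  by exists (index s internals); rewrite // cvar_internal // nth_index.
move=> [d d28 <-]; exists (column_set (nth [::] internals d)); last first.
  by rewrite cvar_internal.
rewrite /= internal_column_set ?internals_triple //.
by have := @mem_nth _ [::] internals d d28; rewrite mem_filter => /andP[].
Qed.

Lemma lift_column_set (i : 'I_7) a b c : (a < 6)%N -> (b < 6)%N -> (c < 6)%N ->
  [set lift i (inord a); lift i (inord b); lift i (inord c)]%SET =
  column_set [:: bump i a; bump i b; bump i c].
Proof.
by move=> a6 b6 c6; apply/setP => x; rewrite !inE -!val_eqE /= !inordK // orbA.
Qed.

Lemma quadX_cvar (i : 'I_7) : tofrac (quadX C (lift i)) = cvar C (28 + i).
Proof.
rewrite /quadX !lift_column_set // /cvar /cvar_coord /cvar_formula addKn.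
rewrite -[35%N]/(28 + 7)%N.
by rewrite ltn_add2l ltn_ord ltnNge leq_addr.
Qed.

Lemma quadY_cvar (i : 'I_7) : tofrac (quadY C (lift i)) = cvar C (35 + i).
Proof.
rewrite /quadY !lift_column_set // /cvar /cvar_coord /cvar_formula addKn.
rewrite -[42%N]/(35 + 7)%N.
rewrite ltn_add2l ltn_ord [(_ < 35)%N]ltnNge leq_addr.
by rewrite ltnNge (leq_trans (isT : 28 <= 35)%N (leq_addr _ _)).
Qed.

Lemma quadratics_cvar :
  [set tofrac (quadX C (lift i)) | i in [set: 'I_7]]
  `|` [set tofrac (quadY C (lift i)) | i in [set: 'I_7]]
  = (fun d => cvar C (28 + d)) @` `I_14.
Proof.
apply/seteqP; split=> f.
  move=> [[i _ <-]|[i _ <-]].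
    by exists i; rewrite ?quadX_cvar //=; apply: leq_trans (ltn_ord i) _.
  exists (7 + i)%N; last by rewrite quadY_cvar addnA.
  by rewrite /= -[14%N]/(7 + 7)%N ltn_add2l.
move=> [d /= d14 <-]; have [d7|d7] := ltnP d 7.
  by left; exists (Ordinal d7) => //; rewrite quadX_cvar.
right; have d7' : (d - 7 < 7)%N by rewrite ltn_subLR.
exists (Ordinal d7') => //.
by rewrite quadY_cvar /= -[35%N]/(28 + 7)%N -addnA subnKC.
Qed.
End Families.

Theorem theorem7 (R : realType) :
  let V : set (func_field R[i] 3 7) := grassmannian_cluster_variables R[i] 3 7 in
  let P : set (func_field R[i] 3 7) :=
    [set tofrac (plucker R[i] 3 K) | K in [set K : {set 'I_7} | internal 3 K]] in
  let Q : set (func_field R[i] 3 7) :=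
    [set tofrac (quadX R[i] (lift i)) | i in [set: 'I_7]]
    `|` [set tofrac (quadY R[i] (lift i)) | i in [set: 'I_7]] in
  [/\ V #= `I_42, P #= `I_28, Q #= `I_14 & V = P `|` Q].
Proof.
move=> V P Q; rewrite /V /P /Q {V P Q} cluster_variables_cvar.
rewrite internal_pluckers_cvar quadratics_cvar.
have inj (m k : nat) : (m + k <= 42)%N ->
    (fun d => cvar R[i] (m + d)) @` `I_k #= `I_k.
  move=> mk; apply: inj_card_eq => d e; rewrite !in_setE /= => dk ek.
  move=> /cvar_inj; rewrite !inE => h; apply: addnI (h _ _).
    by apply: leq_trans mk; rewrite ltn_add2l.
  by apply: leq_trans mk; rewrite ltn_add2l.
split; [exact: (inj 0%N 42%N) | exact: (inj 0%N 28%N) | exact: (inj 28%N 14%N) | ].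
apply/seteqP; split=> f.
  move=> [d /= d42 <-].
  have [d28|d28] := ltnP d 28; first by left; exists d.
  by right; exists (d - 28)%N; rewrite ?subnKC //= ltn_subLR.
move=> [[d /= d28 <-]|[d /= d14 <-]].
  by exists d => //=; apply: ltn_trans d28 _.
by exists (28 + d)%N => //=; rewrite -[42%N]/(28 + 14)%N ltn_add2l.
Qed.
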